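(* Let $x_0\in X$ and set $\overline{x}_0=x_{0,1}=\cdots=x_{0,m}=x_0$. For every $n\in\mathbb{N}=\{0,1,2,\ldots\}$, update via $$(\forall i\in I)\quad x_{n+1,i}=x_{n,i}-\overline{x}_n+\operatorname{Prox}_{g_i}(2\overline{x}_n-x_{n,i}),\qquad \overline{x}_{n+1}=\tfrac1m\sum_{i\in I}x_{n+1,i}.$$ Then $(\overline{x}_n)_{n\in\mathbb{N}}$ converges to some $\overline{x}\in\operatorname{argmin}\big(\sum_{i\in I}g_i(\cdot-v_i)\big)$.
   Context: $X$ is a finite-dimensional real Hilbert space, $m\in\{2,3,\ldots\}$, $I=\{1,\ldots,m\}$, and for each $i\in I$, $g_i\colon X\to\,]-\infty,+\infty]$ is convex, lower semicontinuous and proper. $\mathbf{X}=\bigoplus_{i\in I}X$ is the product Hilbert space ($m$ copies of $X$ with inner product $\sum_i\langle x_i,y_i\rangle$); $\mathbf{g}\colon\mathbf{X}\to\,]-\infty,+\infty]$, $\mathbf{g}((x_i)_{i\in I})=\sum_{i\in I}g_i(x_i)$, with Fenchel conjugate $\mathbf{g}^*$; $\mathbf{\Delta}=\{(x,x,\ldots,x)\in\mathbf{X}:x\in X\}$. $P_C$ denotes the projector onto a nonempty closed convex set $C$, $R_{\mathbf{\Delta}}=2P_{\mathbf{\Delta}}-\operatorname{Id}$, $N_{\mathbf{\Delta}}$ is the normal cone operator ($\mathbf{\Delta}^\perp$ on $\mathbf{\Delta}$, $\varnothing$ elsewhere), and $\operatorname{Prox}_h(x)$ is the unique minimizer of $z\mapsto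 h(z)+\tfrac12\|x-z\|^2$. $\mathbf{T}=\operatorname{Id}-P_{\mathbf{\Delta}}+\operatorname{Prox}_{\mathbf{g}}R_{\mathbf{\Delta}}$; $\mathbf{v}=(v_i)_{i\in I}=P_{\overline{\operatorname{ran}}(\operatorname{Id}-\mathbf{T})}(\mathbf{0})$; $\mathbf{Z}=\{\mathbf{x}\in\mathbf{X}:\mathbf{v}\in N_{\mathbf{\Delta}}(\mathbf{x})+\partial\mathbf{g}(\mathbf{x}-\mathbf{v})\}$. Standing assumptions: $\mathbf{0}\in\mathbf{\Delta}^\perp+\operatorname{dom}\mathbf{g}^*$ and $\mathbf{Z}\neq\varnothing$. *)

(* Defs.v *)
From HB Require Import structures.
From mathcomp Require Import all_boot all_order all_algebra.
From mathcomp Require Import boolp classical_sets functions reals ereal.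
From mathcomp Require Import topology normedtype sequences.

Set Implicit Arguments.
Unset Strict Implicit.
Unset Printing Implicit Defensive.

Import Order.TTheory GRing.Theory Num.Theory.
Import numFieldNormedType.Exports.

Local Open Scope classical_set_scope.
Local Open Scope ring_scope.

(* Finite-dimensional real Hilbert spaces: a norm that comes from an inner
   product, on a finite-dimensional space (hence complete). Positive
   definiteness of [ip] follows from [ip_normE] and the norm axioms. *)
HB.mixin Record NormedVector_hasInner (R : realType) V
    of NormedModule R V & Vector R V := {
  ip : V -> V -> R;
  ipC : forall x y, ip x y = ip y x;
  ipDl : forall x y z, ip (x + y) z = ip x z + ip y z;
  ipZl : forall a x y, ip (a *: x) y = a * ip x y;
  ip_normE : forall x, ip x x = `|x| ^+ 2
}.

#[short(type="euclideanType")]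
HB.structure Definition Euclidean (R : realType) :=
  {V of NormedVector_hasInner R V & NormedModule R V & Vector R V}.

HB.factory Record Vector_hasInner (R : realType) V of Vector R V := {
  inner : V -> V -> R;
  innerC : forall x y, inner x y = inner y x;
  innerDl : forall x y z, inner (x + y) z = inner x z + inner y z;
  innerZl : forall a x y, inner (a *: x) y = a * inner x y;
  inner_ge0 : forall x, 0 <= inner x x;
  inner_eq0 : forall x, inner x x = 0 -> x = 0
}.

HB.builders Context R V of Vector_hasInner R V.

Let nrm (x : V) : R := Num.sqrt (inner x x).

Let nrm_sqr x : nrm x ^+ 2 = inner x x.
Proof. by rewrite sqr_sqrtr// inner_ge0. Qed.

Let innerDr x y z : inner x (y + z) = inner x y + inner x z.
Proof. by rewrite innerC innerDl !(innerC x). Qed.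

Let innerZr a x y : inner x (a *: y) = a * inner x y.
Proof. by rewrite innerC innerZl innerC. Qed.

Let cauchy_schwarz x y : inner x y <= nrm x * nrm y.
Proof.
have nx0 : 0 <= nrm x by exact: sqrtr_ge0.
have ny0 : 0 <= nrm y by exact: sqrtr_ge0.
have [/eqP ny|ny] := eqVneq (nrm y) 0.
  have yy : inner y y = 0 by rewrite -nrm_sqr (eqP ny) expr0n.
  have y0 := inner_eq0 yy; rewrite y0 -(scale0r 0) innerZr mul0r.
  by rewrite mulr_ge0// sqrtr_ge0.
have yy : 0 < inner y y by rewrite -nrm_sqr exprn_gt0// lt_def ny.
have := inner_ge0 (inner y y *: x + (- inner x y) *: y).
rewrite !(innerDl, innerDr, innerZl, innerZr) (innerC y x) => h.
have {}h : 0 <= inner y y * (inner x x * inner y y - inner x y ^+ 2).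
  apply: le_trans h _; rewrite le_eqVlt; apply/orP; left; apply/eqP.
  rewrite mulrBr expr2 !mulNr !mulrN opprK.
  rewrite [inner x y * (inner y y * _)]mulrCA [inner x y * (inner x y * _)]mulrA.
  rewrite [inner x y * inner x y * _]mulrC addNr addr0.
  by congr (_ * _ - _); rewrite mulrC.
rewrite pmulr_rge0// subr_ge0 -!nrm_sqr -exprMn in h.
apply: le_trans (ler_norm _) _.
by rewrite -(ler_pXn2r (n:=2))// ?nnegrE ?mulr_ge0// real_normK ?num_real.
Qed.

Let nrmD x y : nrm (x + y) <= nrm x + nrm y.
Proof.
have nx0 : 0 <= nrm x by exact: sqrtr_ge0.
have ny0 : 0 <= nrm y by exact: sqrtr_ge0.
rewrite -(ler_pXn2r (n:=2))// ?nnegrE ?addr_ge0 ?sqrtr_ge0//.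
rewrite nrm_sqr innerDl !innerDr (innerC y x) sqrrD !nrm_sqr.
rewrite addrA -[inner x x + _ + _]addrA lerD2r lerD2l -mulr2n.
by rewrite lerMn2r/= cauchy_schwarz.
Qed.

Let nrmZ a x : nrm (a *: x) = `|a| * nrm x.
Proof. by rewrite /nrm innerZl innerZr mulrA -expr2 sqrtrM ?sqr_ge0// sqrtr_sqr. Qed.

Let nrm_eq0 x : nrm x = 0 -> x = 0.
Proof. by move=> x0; apply: inner_eq0; rewrite -nrm_sqr x0 expr0n. Qed.

HB.instance Definition _ := Lmodule_isNormed.Build R V nrmD nrmZ nrm_eq0.

Let inner_normE (x : V) : inner x x = `|x| ^+ 2.
Proof. by rewrite -nrm_sqr. Qed.

HB.instance Definition _ :=
  NormedVector_hasInner.Build R V innerC innerDl innerZl inner_normE.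

HB.end.

(* The Hilbert direct sum of m copies of X: an alias of {ffun 'I_m -> X},
   normed by the square root of the sum of the squared norms. *)
Definition hsum (R : realType) (m : nat) (X : euclideanType R) : Type :=
  {ffun 'I_m -> X}.

Section hsum.
Context (R : realType) (m : nat) (X : euclideanType R).

HB.instance Definition _ := Vector.on (hsum m X).

Definition hsum_fun (x : hsum m X) : 'I_m -> X :=
  fun_of_fin (x : {ffun 'I_m -> X}).

Definition hsum_inner (x y : hsum m X) : R :=
  \sum_(i < m) ip (hsum_fun x i) (hsum_fun y i).

Fact hsum_innerC x y : hsum_inner x y = hsum_inner y x.
Proof. by apply: eq_bigr => i _; rewrite ipC. Qed.

Fact hsum_innerDl x y z :
  hsum_inner (x + y) z = hsum_inner x z + hsum_inner y z.
Proof.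
rewrite -big_split; apply: eq_bigr => i _ /=.
by rewrite -ipDl /hsum_fun ffunE.
Qed.

Fact hsum_innerZl a x y : hsum_inner (a *: x) y = a * hsum_inner x y.
Proof. by rewrite big_distrr; apply: eq_bigr => i _ /=; rewrite -ipZl /hsum_fun ffunE. Qed.

Fact hsum_inner_ge0 x : 0 <= hsum_inner x x.
Proof. by apply: sumr_ge0 => i _; rewrite ip_normE sqr_ge0. Qed.

Fact hsum_inner_eq0 x : hsum_inner x x = 0 -> x = 0.
Proof.
move=> /eqP; rewrite psumr_eq0 => [/allP x0|i _]; last by rewrite ip_normE sqr_ge0.
apply/ffunP => i; have := x0 i (mem_index_enum i).
by rewrite /= ip_normE sqrf_eq0 normr_eq0 ffunE => /eqP.
Qed.

HB.instance Definition _ := Vector_hasInner.Build R (hsum m X)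
  hsum_innerC hsum_innerDl hsum_innerZl hsum_inner_ge0 hsum_inner_eq0.

End hsum.

Coercion hsum_fun : hsum >-> Funclass.

Section convex_analysis.
Context (R : realType) (E : euclideanType R).
Implicit Types (f : E -> \bar R) (C : set E) (x u : E).

Definition econvex f := forall x y (t : R), 0 < t < 1 ->
  (f (t *: x + (1 - t) *: y)%R <= t%:E * f x + (1 - t)%:E * f y)%E.

Definition edom f : set E := [set x | (f x < +oo)%E].

(* f takes values in ]-oo, +oo] and is not identically +oo. *)
Definition eproper f := (forall x, f x != -oo%E) /\ edom f !=set0.

Definition argmin f : set E := [set x | forall y, (f x <= f y)%E].

Definition fenchel_conjugate f u : \bar R :=
  ereal_sup [set ((ip x u)%:E - f x)%E | x in setT].

Definition subdifferential f x : set E :=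
  [set u | forall y, (f x + (ip (y - x)%R u)%:E <= f y)%E].

Definition orthogonal_compl C : set E :=
  [set u | forall c, C c -> ip c u = 0].

Definition normal_cone C x : set E :=
  [set u | C x /\ forall c, C c -> ip (c - x) u <= 0].

(* [prox] and [projector] pick the minimizer, and are only meaningful when it
   exists and is unique: f convex, lsc and proper, resp. C nonempty, closed
   and convex. The value 0 is a default. *)
Definition prox f x : E :=
  xget 0 (argmin (fun z => f z + (2^-1 * `|x - z| ^+ 2)%R%:E)%E).

Definition projector C x : E :=
  xget 0 [set p | C p /\ forall c, C c -> `|x - p| <= `|x - c|].

End convex_analysis.

Section douglas_rachford.
Context (R : realType) (m : nat) (X : euclideanType R).
Variable g : 'I_m -> X -> \bar R.

Definition separable_sum (x : hsum m X) : \bar R := (\sum_(i < m) g i (x i))%E.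

Definition hsum_diag : set (hsum m X) :=
  [set x | exists y : X, forall i, x i = y].

Definition reflector_diag (x : hsum m X) : hsum m X :=
  2 *: projector hsum_diag x - x.

Definition dr_op (x : hsum m X) : hsum m X :=
  x - projector hsum_diag x + prox separable_sum (reflector_diag x).

Definition min_displacement : hsum m X :=
  projector (closure [set x - dr_op x | x in setT]) 0.

Definition normal_solutions : set (hsum m X) :=
  [set x | [set a + b | a in normal_cone hsum_diag x
                      & b in subdifferential separable_sum (x - min_displacement)]
           min_displacement].

End douglas_rachford.

Arguments hsum_diag {R m X}.

Lemma normal_cone_diag (R : realType) (m : nat) (X : euclideanType R)
    (x : hsum m X) :
  normal_cone hsum_diag x =
  [set u | hsum_diag x /\ orthogonal_compl hsum_diag u].
Proof.
apply/seteqP; split => u [Dx H]; split => //; last first.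
  move=> c [z cz]; rewrite H//; case: Dx => y xy.
  by exists (z - y) => i; rewrite -(cz i) -(xy i) /hsum_fun !ffunE.
case: Dx => y xy c [z cz].
have h1 : ip c u <= 0.
  rewrite -[c](addrK x); apply: H; exists (z + y) => i.
  by rewrite -(cz i) -(xy i) /hsum_fun !ffunE.
have h2 : ip (- c) u <= 0.
  rewrite -[- c](addrK x); apply: H; exists (- z + y) => i.
  by rewrite -(cz i) -(xy i) /hsum_fun !ffunE.
by apply/eqP; rewrite eq_le h1 -oppr_le0 -mulN1r -ipZl scaleN1r h2.
Qed.

(* Main.v *)
Require Import Defs.
From mathcomp Require Import all_boot all_order all_algebra.
From mathcomp Require Import ring lra finmap.
From mathcomp Require Import boolp classical_sets functions reals ereal.
From mathcomp Require Import topology normedtype sequences.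

Set Implicit Arguments.
Unset Strict Implicit.
Unset Printing Implicit Defensive.

Import Order.TTheory GRing.Theory Num.Theory.
Import numFieldNormedType.Exports VectorInternalTheory.

Local Open Scope classical_set_scope.
Local Open Scope ring_scope.

(** Write Q = Id - P, with P the orthogonal projection onto the diagonal, and f
    for the separable sum of the g_i. One Douglas-Rachford step displaces a
    point by P s - Q y, where y is the proximal point used in the step and s the
    subgradient of f at y that it produces; conversely every pair (y, s) in the
    graph of the subdifferential arises in this way
    ([subdifferential_displacement]). So the minimal displacement v is at most
    as long as every vector P s - Q y.

    The assumption on the conjugate gives u orthogonal to the diagonal such that
    f - <., u> is bounded below. For any y1 in the domain of f, penalising P y
    weakly and Q y strongly in the minimisation of f - <., u> yields pairs (y, s)
    with P s close to 0 and Q y not much longer than Q y1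
    ([displacement_approx]). Hence |v| <= |Q y1| on dom f. A point z of Z puts
    z - v in dom f, and with y1 = z - v this forces P v = 0; varying y1 along
    segments of dom f that start at z - v shows that v is normal to dom f at
    z - v ([minimal_displacement_orth], [minimal_displacement_normal]).

    Therefore, if s is a subgradient of f at z - v orthogonal to the diagonal,
    so is s + t v for every t >= 0. Monotonicity of the subdifferential, used at
    step n with t = n + 1, makes x_n + n v Fejer monotone with respect to z - s
    ([fejer]), so its increments tend to 0. Any cluster point p of P x_n then
    minimises f(. - v) on the diagonal ([cluster_minimal]), and the same s is a
    subgradient at p - v ([cluster_solution]). Two cluster points p and q are
    thus compared with the same s: the squared distances of x_n + n v to p - s
    and q - s both converge, hence so does <P x_n, p - q>, and p = q
    ([cluster_unique]). By compactness P x_n, which is the diagonal vector of the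
    n-th average, converges. *)

(** * Inner products and compactness of balls *)

Section inner_product.
Context (R : realType) (E : euclideanType R).
Implicit Types x y z : E.

Lemma ipDr x y z : ip x (y + z) = ip x y + ip x z.
Proof. by rewrite ipC ipDl !(ipC x). Qed.

Lemma ipZr (a : R) x y : ip x (a *: y) = a * ip x y.
Proof. by rewrite ipC ipZl ipC. Qed.

Lemma ipNl x y : ip (- x) y = - ip x y.
Proof. by rewrite -scaleN1r ipZl mulN1r. Qed.

Lemma ipNr x y : ip x (- y) = - ip x y.
Proof. by rewrite ipC ipNl ipC. Qed.

Lemma ipBl x y z : ip (x - y) z = ip x z - ip y z.
Proof. by rewrite ipDl ipNl. Qed.

Lemma ipBr x y z : ip x (y - z) = ip x y - ip x z.
Proof. by rewrite ipDr ipNr. Qed.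

Lemma ip0l x : ip 0 x = 0.
Proof. by rewrite -(scale0r x) ipZl mul0r. Qed.

Lemma ip0r x : ip x 0 = 0.
Proof. by rewrite ipC ip0l. Qed.

Definition ip_lin := (@ipDl R E, ipDr, ipBl, ipBr, ipNl, ipNr, @ipZl R E, ipZr,
  ip0l, ip0r).

Lemma ip_ge0 x : 0 <= ip x x.
Proof. by rewrite ip_normE sqr_ge0. Qed.

Lemma ip_eq0 x : ip x x = 0 -> x = 0.
Proof. by rewrite ip_normE => /eqP; rewrite sqrf_eq0 normr_eq0 => /eqP. Qed.

(** Cauchy-Schwarz, read off from the triangle inequality. *)
Lemma ip_le_norm x y : ip x y <= `|x| * `|y|.
Proof.
have : `|x + y| ^+ 2 <= (`|x| + `|y|) ^+ 2.
  by rewrite ler_pXn2r ?nnegrE ?addr_ge0// ler_normD.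
rewrite -ip_normE !ip_lin (ipC y x) !ip_normE.
nra.
Qed.

Lemma ler_norm_ip x y : `|ip x y| <= `|x| * `|y|.
Proof.
rewrite ler_norml ip_le_norm andbT lerNl -ipNl -(normrN x).
exact: ip_le_norm.
Qed.

Lemma ip_young x y : ip x y <= 2^-1 * `|x| ^+ 2 + 2^-1 * `|y| ^+ 2.
Proof.
have := ip_ge0 (x - y); rewrite !ip_lin (ipC y x) !ip_normE.
lra.
Qed.

End inner_product.

Section finite_dimension.
Context (R : realType) (E : euclideanType R).

Let n := dim E.
Let c : 'rV[R]_n -> E := r2v.

Let coord_le : exists2 C : R, 0 <= C & forall u, `|c u| <= C * `|u|.
Proof.
exists (\sum_(i < n) `|c (delta_mx 0 i)|); first exact: sumr_ge0.
move=> u; rewrite {1}(row_sum_delta u) /c linear_sum /=.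
apply: le_trans (ler_norm_sum _ _ _) _.
rewrite mulr_suml ler_sum// => i _; rewrite linearZ /= normrZ mulrC.
rewrite ler_wpM2l//.
have /mapP[j Hj e] : `|u ord0 i| \in [seq `|u x.1 x.2| | x : 'I_1 * 'I_n].
  by apply/mapP; exists (ord0, i) => //=; rewrite mem_enum.
rewrite e [leRHS]/Num.norm /= mx_normrE; apply/bigmax_geP; right => /=.
by exists j.
Qed.

Let coord_continuous : continuous c.
Proof.
have [C C0 cC] := coord_le; move=> u; apply/(@cvgrPdist_lt _ _ _ (nbhs u)) => e e0.
have d0 : 0 < e / (C + 1) by rewrite divr_gt0// ltr_wpDl.
have nt : \forall t \near u, `|u - t| < e / (C + 1).
  by apply/nbhs_ballP; exists (e / (C + 1)) => // t; rewrite -ball_normE.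
apply: filterS nt => t ut.
rewrite /c -linearB /=; apply: le_lt_trans (cC _) _.
apply: (@le_lt_trans _ _ ((C + 1) * `|u - t|)).
  by rewrite ler_wpM2r// lerDl.
by rewrite mulrC -ltr_pdivlMr ?ltr_wpDl.
Qed.

Let sphere := [set u : 'rV[R]_n | `|u| = 1].

(** Equivalence of norms: the norm of E is positive on the compact unit sphere of
    the row vectors, so its values there stay away from 0. *)
Let coord_ge : exists2 k : R, 0 < k & forall u, k * `|u| <= `|c u|.
Proof.
have cpt : compact ((fun u => `|c u|) @` sphere).
  apply: continuous_compact.
    apply: continuous_subspaceT => u.
    apply: continuous_comp; first exact: coord_continuous.
    exact: norm_continuous.
  apply: bounded_closed_compact.
    by exists 1; split => // M M1 u /= ->; exact: ltW.
  rewrite (_ : sphere = (fun u : 'rV[R]_n => `|u|) @^-1` [set 1])//.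
  apply: closed_comp => [u _|]; first exact: norm_continuous.
  exact: closed_eq.
have cl := compact_closed (@Rhausdorff R) cpt.
have : nbhs (0 : R) (~` ((fun u => `|c u|) @` sphere)).
  apply: open_nbhs_nbhs; split; first exact: closed_openC.
  move=> [u /= u1 /normr0_eq0 cu0].
  have u0 : u = 0 by apply: (can_inj (@r2vK R E)); rewrite [LHS]cu0 linear0.
  by move: u1; rewrite /sphere /= u0 normr0 => /eqP; rewrite eq_sym oner_eq0.
move=> /nbhs_ballP [k /= k0 kball].
exists k => // u; have [->|u0] := eqVneq u 0; first by rewrite normr0 mulr0.
have nu0 : 0 < `|u| by rewrite normr_gt0.
rewrite -ler_pdivlMr//.
have -> : `|c u| / `|u| = `|c (`|u|^-1 *: u)|.
  by rewrite /c linearZ /= normrZ normfV normr_id mulrC.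
rewrite leNgt; apply/negP => lt_k.
apply: (kball `|c (`|u|^-1 *: u)|).
  by rewrite /ball /= sub0r normrN normr_id.
exists (`|u|^-1 *: u) => //.
by rewrite /sphere /= normrZ normfV normr_id mulVf// gt_eqF.
Qed.

(** Balls of E are closed subsets of the image, under the coordinate map, of a
    ball of the row vectors, where bounded closed sets are compact; the lower
    bound on the coordinate map makes that ball bounded. *)
Lemma closed_ball_compact (x : E) (M : R) : compact [set y | `|y - x| <= M].
Proof.
have [k k0 ck] := coord_ge.
pose B := [set u : 'rV[R]_n | `|u| <= (M + `|x|) / k].
have Bc : compact B.
  apply: bounded_closed_compact.
    exists ((M + `|x|) / k); split; first exact: num_real.
    by move=> N MN u /= /le_trans; apply; exact: ltW.
  rewrite (_ : B = (fun u : 'rV[R]_n => `|u|) @^-1` [set t | t <= (M + `|x|) / k])//.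
  apply: closed_comp => [u _|]; first exact: norm_continuous.
  exact: closed_le.
have imc : compact (c @` B).
  apply: continuous_compact => //.
  exact/continuous_subspaceT/coord_continuous.
apply: (subclosed_compact _ imc).
  rewrite (_ : [set y | _] = (fun y : E => `|y - x|) @^-1` [set t | t <= M])//.
  apply: closed_comp => [y _|]; last exact: closed_le.
  by apply: cvg_norm; apply: cvgB; [exact: cvg_id|exact: cvg_cst].
move=> y /= yM; exists (v2r y); last by rewrite /c v2rK.
rewrite /B /= ler_pdivlMr// mulrC (le_trans (ck _))// /c v2rK.
rewrite -[y](subrK x) (le_trans (ler_normD _ _))// lerD2r//.
Qed.

End finite_dimension.

(** * Lower semicontinuous functions *)

Section semicontinuity.
Context (R : realType).

Lemma lsc_comp (X Y : topologicalType) (f : Y -> \bar R) (h : X -> Y) :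
  lower_semicontinuous f -> continuous h ->
  lower_semicontinuous (fun x => f (h x)).
Proof.
move=> lf ch x a afx; have [V nV Va] := lf _ _ afx.
by exists (h @^-1` V) => [|y /Va//]; exact: ch.
Qed.

Lemma lsc_continuous (X : topologicalType) (q : X -> R) :
  continuous q -> lower_semicontinuous (fun x => (q x)%:E).
Proof.
move=> cq x a; rewrite lte_fin => ax.
exists [set y | a < q y] => //=.
by apply: (cvgr_gt (q x)) => //; exact: cq.
Qed.

Lemma lsc_add (X : topologicalType) (f h : X -> \bar R) :
  (forall x, f x != -oo%E) -> (forall x, h x != -oo%E) ->
  lower_semicontinuous f -> lower_semicontinuous h ->
  lower_semicontinuous (fun x => f x + h x)%E.
Proof.
move=> fN hN lf lh x a afh.
suff [b [c [bf ch abc]]] : exists b c : R,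
    [/\ (b%:E < f x)%E, (c%:E < h x)%E & a <= b + c].
  have [V nV Vb] := lf _ _ bf; have [W nW Wc] := lh _ _ ch.
  exists (V `&` W); first exact: filterI.
  move=> y [/Vb bfy /Wc chy]; apply: le_lt_trans (lteD bfy chy).
  by rewrite -EFinD lee_fin.
move: afh (fN x) (hN x).
case: (f x) => [r||] //; case: (h x) => [s||] // afh _ _.
- rewrite -EFinD lte_fin in afh.
  exists (r - (r + s - a) / 2), (s - (r + s - a) / 2).
  by rewrite !lte_fin; split; lra.
- by exists (r - 1), (a - r + 1); rewrite lte_fin ltry; split => //; lra.
- by exists (a - s + 1), (s - 1); rewrite lte_fin ltry; split => //; lra.
- by exists a, 0; rewrite !ltry; split => //; lra.
Qed.

Lemma lsc_sum (X : topologicalType) (I : Type) (s : seq I)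
    (f : I -> X -> \bar R) :
  (forall i x, f i x != -oo%E) -> (forall i, lower_semicontinuous (f i)) ->
  lower_semicontinuous (fun x => \sum_(i <- s) f i x)%E.
Proof.
move=> fN lf; elim: s => [|i s IHs].
  rewrite (_ : (fun x => _) = fun=> 0%:E).
    by apply: lsc_continuous => x; exact: cvg_cst.
  by apply/funext => x; rewrite big_nil.
rewrite (_ : (fun x => _) = (fun x => f i x + \sum_(j <- s) f j x)%E).
  apply: lsc_add => // x.
  elim: s {IHs} => [|j s IHs]; first by rewrite big_nil.
  by rewrite big_cons adde_eq_ninfty negb_or fN.
by apply/funext => x; rewrite big_cons.
Qed.

(** Were there no minimiser, the open sets of points lying strictly above the value
    of f at some y in B would cover B; finitely many of those y suffice, and the
    best of them is covered by none. *)
Lemma lsc_attains_min (X : ptopologicalType) (f : X -> \bar R) (B : set X) :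
  compact B -> B !=set0 -> (forall x, f x != -oo%E) ->
  lower_semicontinuous f ->
  exists2 x, B x & forall y, B y -> (f x <= f y)%E.
Proof.
move=> cB [b Bb] fN lf; apply: contrapT => nomin.
have {}nomin x : B x -> exists2 y, B y & (f y < f x)%E.
  move=> Bx; apply: contrapT => h; apply: nomin; exists x => // y By.
  by rewrite leNgt; apply/negP => yx; apply: h; exists y.
have /(_ X B (fun y => [set x | f y < f x]%E))[] :
    cover_compact B by rewrite -compact_cover.
- move=> y By; move: (fN y); case: (f y) => [r||] // _.
    by move/lower_semicontinuousP : lf; exact.
  rewrite (_ : [set x | _] = set0); first exact: open0.
  by apply/seteqP; split => // x /=; rewrite ltNge leey.
- by move=> x /nomin[y By yx]; exists y.
move=> D DB Dcov.
have : exists2 y, y \in D & forall z, z \in D -> (f y <= f z)%E.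
  have [d Dd _] : exists2 d, d \in D & (f d < f b)%E by have [d] := Dcov _ Bb; exists d.
  exists (fsval [arg min_(z < FSetSub Dd) f (fsval z)]%O).
    exact: fsvalP.
  case: arg_minP => //= z _ zmin t tD.
  exact: (zmin (FSetSub tD)).
move=> [y Dy ymin]; have By : B y by have := DB _ Dy; rewrite inE.
have [z /= Dz] := Dcov _ By.
by rewrite ltNge ymin.
Qed.

End semicontinuity.

(** * Subgradients and proximal points *)

(** Lets a first-order perturbation tend to zero in an inequality. *)
Lemma le_of_le_add_small (R : realFieldType) (a b c : R) :
  (forall t, 0 < t < 1 -> a <= b + t * c) -> a <= b.
Proof.
move=> h; rewrite leNgt; apply/negP => ba.
pose t := Num.min 2^-1 ((a - b) / (2 * (`|c| + 1))).
have c1 : 0 < 2 * (`|c| + 1) by rewrite mulr_gt0// ltr_wpDl.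
have t0 : 0 < t by rewrite lt_min invr_gt0 ltr0n divr_gt0// subr_gt0.
have t1 : t < 1 by rewrite gt_min invf_lt1 ?ltr1n.
have := h t; rewrite t0 t1 => /(_ isT).
have : t * (2 * (`|c| + 1)) <= a - b by rewrite -ler_pdivlMr// ge_min lexx orbT.
have := ler_norm c; nra.
Qed.

Section subgradient.
Context (R : realType) (E : euclideanType R).
Implicit Types (f : E -> \bar R) (x y z u s : E).

Lemma edom_fin_num f x : (forall y, f y != -oo%E) -> edom f x ->
  f x = (fine (f x))%:E.
Proof. by move=> fN fx; rewrite fineK// fin_numE fN/= lt_eqF. Qed.

Lemma subdifferential_edom f x u : eproper f -> subdifferential f x u -> edom f x.
Proof.
move=> [fN [y fy]] /(_ y); rewrite /edom /= in fy *.
move: (fN y) (fN x) fy; case: (f y) => [r||]//; case: (f x) => [s||]// _ _ _.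
by rewrite ltry.
Qed.

Lemma subdifferential_fine f x u y : eproper f -> subdifferential f x u ->
  edom f y -> fine (f x) + ip (y - x) u <= fine (f y).
Proof.
move=> pf fxu fy; have fx := subdifferential_edom pf fxu.
have [fN _] := pf.
by have := fxu y; rewrite (edom_fin_num fN fx) (edom_fin_num fN fy) -EFinD lee_fin.
Qed.

Lemma subdifferentialP f x u : (forall y, f y != -oo%E) -> edom f x ->
  (forall y, edom f y -> fine (f x) + ip (y - x) u <= fine (f y)) ->
  subdifferential f x u.
Proof.
move=> fN fx h y; case: (ltP (f y) +oo%E) => [fy|]; last first.
  by rewrite leye_eq => /eqP ->; rewrite leey.
rewrite (edom_fin_num fN fx) (edom_fin_num fN fy) -EFinD lee_fin.
exact: h.
Qed.

Lemma subdifferential_monotone f x y u s : eproper f ->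
  subdifferential f x u -> subdifferential f y s -> 0 <= ip (x - y) (u - s).
Proof.
move=> pf fxu fys.
have := subdifferential_fine pf fxu (subdifferential_edom pf fys).
have := subdifferential_fine pf fys (subdifferential_edom pf fxu).
rewrite !ip_lin; lra.
Qed.

Lemma econvex_fine f x y (t : R) : (forall y, f y != -oo%E) -> econvex f ->
  edom f x -> edom f y -> 0 < t < 1 ->
  edom f (x + t *: (y - x)) /\
  fine (f (x + t *: (y - x))) <= fine (f x) + t * (fine (f y) - fine (f x)).
Proof.
move=> fN cf fx fy t01.
have := cf y x t t01.
rewrite (_ : t *: y + (1 - t) *: x = x + t *: (y - x)); last first.
  by rewrite scalerBl scale1r scalerBr addrCA addrA.
rewrite (edom_fin_num fN fx) (edom_fin_num fN fy) -!EFinM -EFinD => h.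
have fxy : edom f (x + t *: (y - x)) by rewrite /edom /=; apply: le_lt_trans h (ltry _).
split => //; move: h; rewrite (edom_fin_num fN fxy) lee_fin /=; lra.
Qed.

(** The objective of the proximal problem at y + s exceeds its value at y by at
    least half the squared distance to y, so y is the only minimiser. *)
Lemma prox_subdifferential f y s : eproper f -> subdifferential f y s ->
  prox f (y + s) = y.
Proof.
move=> pf fys; have [fN _] := pf; have fy := subdifferential_edom pf fys.
have lt_y z : z != y ->
    (f y + (2^-1 * `|(y + s) - y| ^+ 2)%:E < f z + (2^-1 * `|(y + s) - z| ^+ 2)%:E)%E.
  move=> zy; case: (ltP (f z) +oo%E) => [fz|]; last first.
    by rewrite leye_eq => /eqP ->; rewrite (edom_fin_num fN fy) addye// ltry.
  rewrite (edom_fin_num fN fy) (edom_fin_num fN fz) -!EFinD lte_fin.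
  have := subdifferential_fine pf fys fz.
  rewrite -!ip_normE.
  have : 0 < ip (z - y) (z - y).
    by rewrite ip_normE exprn_gt0// normr_gt0 subr_eq0.
  rewrite !ip_lin (ipC z s) (ipC y s) (ipC z y).
  lra.
apply: xget_unique => [z|z /= zmin]; first by have [->//|/lt_y/ltW] := eqVneq z y.
apply/eqP; apply: contraT => /lt_y; rewrite ltNge; by rewrite zmin.
Qed.

Lemma sqr_dist_continuous x : continuous (fun z => 2^-1 * `|x - z| ^+ 2 : R).
Proof.
move=> z; apply: cvgM; first exact: cvg_cst.
rewrite (_ : (fun _ => _) = (fun z => `|x - z| * `|x - z|)).
  rewrite expr2; apply: cvgM; apply: cvg_norm; apply: cvgB;
    [exact: cvg_cst|exact: cvg_id|exact: cvg_cst|exact: cvg_id].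
by apply/funext => t; rewrite expr2.
Qed.

(** The affine minorant makes the objective coercive, so that its minimiser on a
    large ball is global. *)
Lemma prox_argmin f x u (K : R) : eproper f -> lower_semicontinuous f ->
  (forall y, (ip y u - K)%:E <= f y)%E ->
  argmin (fun z => f z + (2^-1 * `|x - z| ^+ 2)%:E)%E (prox f x).
Proof.
move=> [fN [a fa]] lf fu; set F := fun z => _.
suff [y Fy] : exists y, argmin F y by apply: (xgetPex 0); exists y.
have FN z : F z != -oo%E by rewrite adde_eq_ninfty negb_or fN.
have lF : lower_semicontinuous F.
  by apply: lsc_add => //; apply: lsc_continuous; exact: sqr_dist_continuous.
pose c := fine (f a) + 2^-1 * `|x - a| ^+ 2.
have Fa : F a = c%:E by rewrite /F (edom_fin_num fN fa).
pose b := c + K - ip x u.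
(* The ball contains a; outside it the quadratic term beats the affine minorant
   by more than the value at a. *)
pose M := Num.max `|a - x| (2 * `|u| + 1 + 2 * `|b|).
have [|y By ymin] := lsc_attains_min (@closed_ball_compact R E x M) _ FN lF.
  by exists a; rewrite /= le_max lexx.
exists y => z; case: (leP `|z - x| M) => [/ymin//|Mz].
have ay : (F y <= F a)%E by apply: ymin; rewrite /= le_max lexx.
apply: le_trans ay _; rewrite Fa.
suff : (c%:E <= (ip z u - K)%:E + (2^-1 * `|x - z| ^+ 2)%:E)%E.
  by move/le_trans; apply; rewrite leeD2r.
rewrite -EFinD lee_fin distrC.
have := ip_le_norm (x - z) u; rewrite ipBl (distrC x z).
move: Mz; rewrite gt_max => /andP[_].
rewrite /b; have := ler_norm (c + K - ip x u).
have := normr_ge0 u; have := normr_ge0 (c + K - ip x u).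
set B := `|c + K - ip x u|; set U := `|u|; set h := `|z - x|.
move=> B0 U0 cB hB hU.
have : (2^-1 * h - U) >= 2^-1 + B by lra.
nra.
Qed.

(** Optimality is tested along the segment from the proximal point to any z: to
    first order the quadratic term decreases by the inner product of the step with
    x minus the proximal point. *)
Lemma subdifferential_prox f x u (K : R) : econvex f -> eproper f ->
  lower_semicontinuous f -> (forall y, (ip y u - K)%:E <= f y)%E ->
  subdifferential f (prox f x) (x - prox f x).
Proof.
move=> cf pf lf fu; have := prox_argmin x pf lf fu; set y := prox f x => ymin.
have [fN [a fa]] := pf.
have fy : edom f y.
  have := ymin a; rewrite (edom_fin_num fN fa) -EFinD.
  by move: (fN y); rewrite /edom /=; case: (f y) => [r||]// _ _; rewrite ltry.
apply: subdifferentialP => // z fz.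
apply: (@le_of_le_add_small _ _ _ (2^-1 * `|z - y| ^+ 2)) => t t01.
have [ft fle] := econvex_fine fN cf fy fz t01.
have := ymin (y + t *: (z - y)).
rewrite (edom_fin_num fN fy) (edom_fin_num fN ft) -!EFinD lee_fin.
rewrite opprD addrA.
have [t0 t1] := andP t01.
set d := z - y in fle *; set e := x - y; clearbody d e.
rewrite -!ip_normE !ip_lin (ipC e d) => h.
have : t * (fine (f y) + ip d e) <= t * (fine (f z) + t * (2^-1 * ip d d)) by lra.
by rewrite ler_pM2l.
Qed.

End subgradient.

(** * Orthogonal projections and the minimal displacement *)

Definition orthogonal_projection (R : realType) (E : euclideanType R)
    (P : E -> E) :=
  [/\ linear P, (forall x, P (P x) = P x) & forall x y, ip (P x) y = ip x (P y)].

Section projection_lemmas.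
Context (R : realType) (E : euclideanType R) (P : E -> E).
Hypothesis HP : orthogonal_projection P.
Implicit Types (x y z : E).

Lemma oprojD x y : P (x + y) = P x + P y.
Proof. by case: HP => l _ _; rewrite -[x]scale1r l !scale1r. Qed.

Lemma oproj0 : P 0 = 0.
Proof. by apply: (addrI (P 0)); rewrite -oprojD !addr0. Qed.

Lemma oprojZ (a : R) x : P (a *: x) = a *: P x.
Proof. by case: HP => l _ _; rewrite -[a *: x]addr0 l oproj0 addr0. Qed.

Lemma oprojN x : P (- x) = - P x.
Proof. by rewrite -scaleN1r oprojZ scaleN1r. Qed.

Lemma oprojB x y : P (x - y) = P x - P y.
Proof. by rewrite oprojD oprojN. Qed.

Lemma oprojK x : P (P x) = P x. Proof. by case: HP. Qed.

Lemma oproj_adj x y : ip (P x) y = ip x (P y). Proof. by case: HP. Qed.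

Lemma oprojC x : P (x - P x) = 0.
Proof. by rewrite oprojB oprojK subrr. Qed.

Lemma oproj_orth x y : P x = x -> P y = 0 -> ip x y = 0.
Proof. by move=> <- y0; rewrite oproj_adj y0 ip0r. Qed.

Lemma oproj_pythagoras x : `|x| ^+ 2 = `|P x| ^+ 2 + `|x - P x| ^+ 2.
Proof.
have := oproj_orth (oprojK x) (oprojC x); rewrite -!ip_normE !ip_lin (ipC x (P x)).
lra.
Qed.

Lemma oproj_le x : `|P x| <= `|x|.
Proof.
rewrite -(ler_pXn2r (n := 2))// ?nnegrE// (oproj_pythagoras x).
by rewrite lerDl sqr_ge0.
Qed.

Lemma oproj_continuous : continuous P.
Proof.
move=> x; apply/(@cvgrPdist_lt _ _ _ (nbhs x)) => e e0.
have : \forall t \near x, `|x - t| < e.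
  by apply/nbhs_ballP; exists e => // t; rewrite -ball_normE.
by apply: filterS => t; apply: le_lt_trans; rewrite -oprojB oproj_le.
Qed.

(** For large a, substituting [stretch a] in f before taking a proximal point
    weakens the penalty on P y and strengthens the one on y - P y. *)
Definition stretch (a : R) x := a *: P x + a^-1 *: (x - P x).

Lemma stretch_oproj a x : P (stretch a x) = a *: P x.
Proof. by rewrite /stretch oprojD !oprojZ oprojK oprojC scaler0 addr0. Qed.

Lemma stretch_oprojC a x : stretch a x - P (stretch a x) = a^-1 *: (x - P x).
Proof. by rewrite stretch_oproj /stretch addrC addKr. Qed.

Lemma stretchD a x y : stretch a (x + y) = stretch a x + stretch a y.
Proof.
by rewrite /stretch oprojD opprD addrACA !scalerDr addrACA.
Qed.

Lemma stretchZ a b x : stretch a (b *: x) = b *: stretch a x.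
Proof.
by rewrite /stretch oprojZ -scalerBr !scalerA mulrC (mulrC _ b) -!scalerA -scalerDr.
Qed.

Lemma stretchB a x y : stretch a (x - y) = stretch a x - stretch a y.
Proof. by rewrite stretchD -scaleN1r stretchZ scaleN1r. Qed.

Lemma stretchK a x : a != 0 -> stretch a^-1 (stretch a x) = x.
Proof.
move=> a0; rewrite {1}/stretch stretch_oprojC stretch_oproj !scalerA.
by rewrite invrK mulVf// mulfV// !scale1r addrC subrK.
Qed.

Lemma stretch_adj a x y : ip (stretch a x) y = ip x (stretch a y).
Proof. by rewrite /stretch !ip_lin oproj_adj. Qed.

Lemma stretch_continuous a : continuous (stretch a).
Proof.
move=> x; apply: cvgD; apply: cvgZr.
  exact: oproj_continuous.
by apply: cvgB; [exact: cvg_id|exact: oproj_continuous].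
Qed.

End projection_lemmas.

Section minimal_displacement.
Context (R : realType) (E : euclideanType R) (P : E -> E) (f : E -> \bar R).
Hypothesis HP : orthogonal_projection P.
Hypothesis cf : econvex f.
Hypothesis lf : lower_semicontinuous f.
Hypothesis pf : eproper f.

(** Let L be the stretching by a large k, and w the proximal point of f o L at
    L u. Then y = L w has the subgradient s = u - L^-1 w, the displacement
    P s - (y - P y) is exactly - w / k, and the subgradient inequality
    between w and L^-1 y1 bounds the norm of w. *)
Lemma displacement_approx (u : E) (K : R) (y1 : E) (e : R) :
  P u = 0 -> (forall y, (ip y u - K)%:E <= f y)%E -> edom f y1 -> 0 < e ->
  exists y s, subdifferential f y s /\
    `|P s - (y - P y)| ^+ 2 <= `|y1 - P y1| ^+ 2 + e.
Proof.
move=> Pu fu fy1 e0; have [fN _] := pf.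
(* The squared displacement is at most |y1 - P y1| ^ 2 + D / k ^ 2, and k is
   chosen to make the last term at most e. *)
pose D := 2 * (fine (f y1) + K - ip y1 u) + `|P y1| ^+ 2.
pose k := 1 + `|D| / e.
have k1 : 1 <= k by rewrite lerDl divr_ge0// ltW.
have k0 : 0 < k by apply: lt_le_trans k1.
have kn0 : k != 0 by rewrite gt_eqF.
pose L := stretch P k; pose L' := stretch P k^-1.
have LK x : L' (L x) = x by exact: stretchK.
have L'K x : L (L' x) = x.
  by have := stretchK HP x (invr_neq0 kn0); rewrite invrK.
pose h x := f (L x).
have Lu : L u = k^-1 *: u by rewrite /L /stretch Pu scaler0 add0r subr0.
have hdom x : edom f x -> edom h (L' x) by rewrite /edom /h /= L'K.
have ph : eproper h.
  by split; [move=> x; exact: fN|exists (L' y1); exact: hdom].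
have lh : lower_semicontinuous h.
  by apply: lsc_comp => //; exact: stretch_continuous.
have ch : econvex h.
  by move=> x y t t01; rewrite /h /L stretchD// !stretchZ//; exact: cf.
have hu y : ((ip y (L u) - K)%:E <= h y)%E.
  by rewrite /L -(stretch_adj HP); exact: fu.
have := subdifferential_prox (L u) ch ph lh hu.
set w := prox h (L u) => sw.
have hw := subdifferential_edom ph sw.
exists (L w), (u - L' w); split.
  apply: subdifferentialP => // y fy.
  have := subdifferential_fine ph sw (hdom _ fy).
  rewrite /h L'K => /(le_trans _); apply; rewrite lerD2l.
  have -> : y - L w = L (L' y - w) by rewrite /L stretchB// -/L L'K.
  rewrite {2}/L stretch_adj// -/L /L stretchB// -/L L'K.
  exact: lexx.
have -> : P (u - L' w) - (L w - P (L w)) = - (k^-1 *: w).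
  rewrite stretch_oprojC// oprojB// Pu sub0r stretch_oproj//.
  by rewrite -opprD -scalerDr addrC subrK.
rewrite normrN normrZ gtr0_norm ?invr_gt0// exprMn.
have wle : `|w| ^+ 2 <= 2 * (fine (f y1) + K - ip y1 u) + `|L' y1| ^+ 2.
  have := subdifferential_fine ph sw (hdom _ fy1).
  have : ip w (L u) - K <= fine (h w).
    by rewrite -lee_fin -(edom_fin_num ph.1 hw); exact: hu.
  have : ip (L' y1) (L u) = ip y1 u by rewrite /L -stretch_adj// -/L L'K.
  have := ip_young (L' y1) w.
  rewrite /h L'K !ip_lin -!ip_normE; lra.
have L'y1 : `|L' y1| ^+ 2 = k^-1 ^+ 2 * `|P y1| ^+ 2 + k ^+ 2 * `|y1 - P y1| ^+ 2.
  rewrite (oproj_pythagoras HP (L' y1)) /L' stretch_oprojC// stretch_oproj// invrK.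
  by rewrite !normrZ normfV gtr0_norm// !exprMn.
have kV1 : k^-1 ^+ 2 <= 1.
  by apply: exprn_ile1; [rewrite invr_ge0 ltW|rewrite invf_le1].
have : k^-1 ^+ 2 * `|D| <= e.
  rewrite exprVn mulrC ler_pdivrMr ?exprn_gt0//.
  have : `|D| = (k - 1) * e by rewrite /k addrAC subrr add0r divfK// gt_eqF.
  move=> ->; rewrite mulrC ler_pM2l//.
  nra.
have kV0 : 0 < k^-1 ^+ 2 by rewrite exprn_gt0// invr_gt0.
have kk : k^-1 ^+ 2 * k ^+ 2 = 1 by rewrite -exprMn mulVf// expr1n.
have P0 := sqr_ge0 `|P y1|.
move: wle; rewrite L'y1.
set q := k^-1 ^+ 2 in kV0 kk kV1 *; set A := `|P y1| ^+ 2 in P0 *.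
set C := fine (f y1) + K - ip y1 u; set W := `|w| ^+ 2; set Y := `|y1 - P y1| ^+ 2.
move=> wle qD; have DD : 2 * C + A <= `|D| := ler_norm D.
apply: (@le_trans _ _ (q * (2 * C + (q * A + k ^+ 2 * Y)))).
  by rewrite ler_wpM2l// ltW.
have -> : q * (2 * C + (q * A + k ^+ 2 * Y)) = q * (2 * C + q * A) + (q * k ^+ 2) * Y.
  by ring.
rewrite kk mul1r addrC lerD2l (le_trans _ qD)// ler_wpM2l//; first exact: ltW.
by apply: (le_trans _ DD); rewrite lerD2l ler_piMl.
Qed.

(** At y = z - v the bound reads |v| <= |v - P v|, which Pythagoras only allows
    if P v = 0. *)
Lemma minimal_displacement_orth (v z : E) :
  (forall y, edom f y -> `|v| <= `|y - P y|) -> P z = z -> edom f (z - v) ->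
  P v = 0.
Proof.
move=> vmin Pz fzv; have := vmin _ fzv.
have -> : z - v - P (z - v) = P v - v.
  by rewrite oprojB// Pz opprB addrC addrA subrK.
rewrite -(ler_pXn2r (n := 2))// ?nnegrE// (oproj_pythagoras HP v) (distrC v).
by rewrite gerDr => Pv; apply/ip_eq0/le_anti; rewrite ip_ge0 andbT ip_normE.
Qed.

(** The bound along the segment from z - v to y says that - v does not get shorter
    when it is moved in the direction of the component of y - (z - v) in the kernel
    of P. *)
Lemma minimal_displacement_normal (v z y : E) :
  (forall y, edom f y -> `|v| <= `|y - P y|) -> P z = z -> edom f (z - v) ->
  edom f y -> ip (y - (z - v)) v <= 0.
Proof.
move=> vmin Pz fzv fy; have Pv := minimal_displacement_orth vmin Pz fzv.
have [fN _] := pf.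
set q := y - (z - v); pose r := q - P q.
have rv : ip r v = ip q v by rewrite /r ipBl oproj_adj// Pv ip0r subr0.
rewrite -rv; apply: (@le_of_le_add_small _ _ _ (2^-1 * `|r| ^+ 2)) => t t01.
have [ft _] := econvex_fine fN cf fzv fy t01.
have := vmin _ ft; rewrite -/q.
have -> : z - v + t *: q - P (z - v + t *: q) = t *: r - v.
  have Pzv : P (z - v) = z by rewrite oprojB// Pz Pv subr0.
  rewrite (oprojD HP) Pzv (oprojZ HP) opprD addrACA -scalerBr -/r.
  by rewrite [z - v - z]addrAC subrr add0r addrC.
clearbody r.
rewrite -(ler_pXn2r (n := 2))// ?nnegrE// -!ip_normE !ip_lin (ipC v r).
have [t0 t1] := andP t01 => h.
have : t * ip r v <= t * (t * (2^-1 * ip r r)) by lra.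
by rewrite add0r ler_pM2l.
Qed.

End minimal_displacement.

(** * Convergence of the shadow sequence *)

(** Reduces an identity between vectors to one between scalars. *)
Lemma ip_ext (R : realType) (E : euclideanType R) (x y : E) :
  (forall z, ip x z = ip y z) -> x = y.
Proof. by move=> h; apply/subr0_eq/ip_eq0; rewrite ipBl h subrr. Qed.

Lemma cluster_often (X : topologicalType) (u : nat -> X) (q : X)
    (Q : nat -> Prop) (B : set X) :
  cluster (u @ \oo) q -> (\forall n \near \oo, Q n) -> nbhs q B ->
  exists2 n, Q n & B (u n).
Proof.
move=> cl nQ nB; have [] := cl (u @` [set n | Q n]) B _ nB.
  by apply: filterS nQ => n Qn; exists n.
by move=> _ [[n Qn <-] Bun]; exists n.
Qed.

Lemma oproj_compl_le (R : realType) (E : euclideanType R) (P : E -> E) x :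
  orthogonal_projection P -> `|x - P x| <= `|x|.
Proof.
move=> HP; rewrite -(ler_pXn2r (n := 2))// ?nnegrE// (oproj_pythagoras HP x).
by rewrite lerDr sqr_ge0.
Qed.

Section douglas_rachford_convergence.
Context (R : realType) (E : euclideanType R) (P : E -> E) (f : E -> \bar R).
Hypothesis HP : orthogonal_projection P.
Hypothesis lf : lower_semicontinuous f.
Hypothesis pf : eproper f.
Variables (v z s : E) (x y : nat -> E).
Hypothesis Pv : P v = 0.
Hypothesis Pz : P z = z.
Hypothesis Ps : P s = 0.
Hypothesis fs : subdifferential f (z - v) s.
Hypothesis normal : forall t, edom f t -> ip (t - (z - v)) v <= 0.
Hypothesis xS : forall n, x n.+1 = x n - P (x n) + y n.
Hypothesis ys : forall n, subdifferential f (y n) (2 *: P (x n) - x n - y n).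

(** Adding n v cancels the drift of x: the result is Fejer monotone although x
    itself need not be bounded. *)
Let w n := x n + n%:R *: v.
Let D n := w n.+1 - w n.

Let Pw n : P (w n) = P (x n).
Proof. by rewrite /w oprojD// oprojZ// Pv scaler0 addr0. Qed.

Let DE n : D n = y n - P (x n) + v.
Proof.
apply: ip_ext => t; rewrite /D /w xS -natr1 !ip_lin; ring.
Qed.

Let PD n : P (D n) = P (x n.+1) - P (x n).
Proof. by rewrite /D oprojB// !Pw. Qed.

Let normal_translate p t : P p = p -> edom f t ->
  ip (t - (p - v)) v <= 0.
Proof.
move=> Pp /normal; apply: le_trans; rewrite le_eqVlt; apply/orP; left.
have /eqP := oproj_orth HP Pp Pv; have := oproj_orth HP Pz Pv.
by rewrite !ip_lin => -> /eqP ->.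
Qed.

(** The subgradient s is the same for all p: this lets different limit candidates
    be compared through one Fejer sequence. *)
Definition is_solution p := P p = p /\ subdifferential f (p - v) s.

(** Since v is normal to dom f at p - v, the vector s + (n + 1) v is a subgradient
    there. Its monotonicity against the subgradient at y n splits along the range
    and the kernel of P and says that the increment of w makes a nonnegative
    inner product with p - s - w n.+1. *)
Lemma fejer p n : is_solution p ->
  `|w n.+1 - (p - s)| ^+ 2 + `|D n| ^+ 2 <= `|w n - (p - s)| ^+ 2.
Proof.
move=> [Pp fp]; have [fN _] := pf.
have fpv := subdifferential_edom pf fp.
have fpn : subdifferential f (p - v) (s + n.+1%:R *: v).
  apply: subdifferentialP => // t ft.
  apply: le_trans (subdifferential_fine pf fp ft).
  rewrite lerD2l ipDr gerDl ipZr pmulr_rle0//.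
  exact: normal_translate.
have := subdifferential_monotone pf (ys n) fpn.
pose al := P (x n.+1) - p; pose de := w n.+1 - P (w n.+1) + s.
pose ga := - P (D n); pose be := D n - P (D n).
have Pal : P al = al by rewrite /al oprojB// oprojK// Pp.
have Pga : P ga = ga by rewrite /ga oprojN// oprojK.
have Pde : P de = 0 by rewrite /de oprojD// oprojC// Ps addr0.
have Pbe : P be = 0 by rewrite oprojC.
have -> : y n - (p - v) = al + be.
  by apply: ip_ext => t; rewrite /al /be PD DE !ip_lin; ring.
have -> : 2 *: P (x n) - x n - y n - (s + n.+1%:R *: v) = ga - de.
  apply: ip_ext => t; rewrite /ga /de PD Pw /w xS !ip_lin; ring.
have -> : w n.+1 - (p - s) = al + de.
  by apply: ip_ext => t; rewrite /al /de Pw !ip_lin; ring.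
have -> : D n = be - ga.
  by apply: ip_ext => t; rewrite /be /ga !ip_lin; ring.
have -> : w n - (p - s) = al + de + ga - be.
  by apply: ip_ext => t; rewrite /al /de /ga /be /D Pw !ip_lin; ring.
(* What remains is the expansion of squares, with the cross terms between the
   range and the kernel of P equal to zero. *)
have := oproj_orth HP Pal Pbe; have := oproj_orth HP Pal Pde.
have := oproj_orth HP Pga Pbe; have := oproj_orth HP Pga Pde.
clearbody al be ga de.
rewrite -!ip_normE !ip_lin.
rewrite (ipC be al) (ipC be ga) (ipC de al) (ipC de ga) (ipC ga al) (ipC de be).
lra.
Qed.

Let zsol : is_solution z. Proof. by split. Qed.

Let A p n := `|w n - (p - s)| ^+ 2.

Lemma fejer_dist_cvg p : is_solution p -> cvgn (A p).
Proof.
move=> sp; apply: nonincreasing_is_cvgn.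
  apply/nonincreasing_seqP => n; rewrite /A.
  by apply: le_trans (fejer n sp); rewrite lerDl sqr_ge0.
by exists 0 => _ [n _ <-]; rewrite sqr_ge0.
Qed.

Lemma increments_vanish e : 0 < e -> \forall n \near \oo, `|D n| < e.
Proof.
move=> e0; have /cvg_ex[l Al] := fejer_dist_cvg zsol.
have AS : (fun n => A z n.+1) @ \oo --> l by rewrite cvg_shiftS.
have /cvgr0Pnorm_lt : (fun n => A z n - A z n.+1) @ \oo --> (0 : R).
  by rewrite -(subrr l); exact: cvgB.
move=> /(_ (e ^+ 2)); rewrite exprn_gt0// => /(_ isT).
apply: filterS => n; have := fejer n zsol; rewrite -/(A z n) -/(A z n.+1) => h.
move=> /(le_lt_trans (ler_norm _)) An.
rewrite -(ltr_pXn2r (n := 2))// ?nnegrE// ?ltW//.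
by apply: le_lt_trans An; lra.
Qed.

Let M := `|w 0 - (z - s)|.

Lemma governing_bounded n : `|w n - (z - s)| <= M.
Proof.
elim: n => // n; apply: le_trans.
rewrite -(ler_pXn2r (n := 2))// ?nnegrE//.
by apply: le_trans (fejer n zsol); rewrite lerDl sqr_ge0.
Qed.

Lemma shadow_bounded n : `|P (w n) - z| <= M.
Proof.
apply: le_trans (governing_bounded n); apply: le_trans (oproj_le HP _).
by rewrite (oprojB HP (w n)) (oprojB HP z) Pz Ps subr0.
Qed.

Lemma complement_bounded n : `|w n - P (w n)| <= M + `|s|.
Proof.
have -> : w n - P (w n) = (w n - (z - s)) - P (w n - (z - s)) - s.
  rewrite (oprojB HP (w n)) (oprojB HP z) Pz Ps subr0.
  by apply: ip_ext => t; rewrite !ip_lin; ring.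
apply: le_trans (ler_normB _ _) _; rewrite lerD2r.
by apply: le_trans (governing_bounded n); exact: oproj_compl_le.
Qed.

(** The subgradient at y n contains the unbounded term (n + 1) v, but normality
    gives this term the favourable sign for points t - v with t in the range of P.
    What is left is bounded, up to a constant, by the increment of w. *)
Lemma value_bound n t : P t = t -> edom f (t - v) ->
  fine (f (y n)) <= fine (f (t - v)) + (`|t - z| + M + (M + `|s|)) * `|D n|.
Proof.
move=> Pt ft; have := subdifferential_fine pf (ys n) ft.
pose al := t - P (w n.+1); pose om := w n.+1 - P (w n.+1).
pose ga := - P (D n); pose be := D n - P (D n).
have Pal : P al = al by rewrite /al oprojB// oprojK// Pt.
have Pga : P ga = ga by rewrite /ga oprojN// oprojK.
have Pom : P om = 0 by rewrite /om oprojC.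
have Pbe : P be = 0 by rewrite oprojC.
have := normal_translate Pt (subdifferential_edom pf (ys n)).
have -> : y n - (t - v) = be - al.
  by apply: ip_ext => h; rewrite /al /be PD Pw DE !ip_lin; ring.
have -> : t - v - y n = al - be.
  by apply: ip_ext => h; rewrite /al /be PD Pw DE !ip_lin; ring.
have -> : 2 *: P (x n) - x n - y n = ga - om + n.+1%:R *: v.
  apply: ip_ext => h; rewrite /ga /om PD Pw /w xS !ip_lin; ring.
have := oproj_orth HP Pal Pom; have := oproj_orth HP Pga Pbe.
have alle : `|al| <= `|t - z| + M.
  have -> : al = (t - z) - (P (w n.+1) - z).
    by apply: ip_ext => h; rewrite /al !ip_lin; ring.
  by apply: le_trans (ler_normB _ _) _; rewrite lerD2l shadow_bounded.
have omle : `|om| <= M + `|s| := complement_bounded n.+1.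
have gale : `|ga| <= `|D n| by rewrite normrN oproj_le.
have bele : `|be| <= `|D n| by apply: oproj_compl_le.
have h1 : `|al| * `|ga| <= (`|t - z| + M) * `|D n| by apply: ler_pM.
have h2 : `|om| * `|be| <= (M + `|s|) * `|D n| by apply: ler_pM.
have := ip_le_norm (- al) ga; rewrite normrN.
have := ip_le_norm (- om) be; rewrite normrN.
clearbody al be ga om.
have n0 : 0 < n.+1%:R :> R by rewrite ltr0n.
rewrite !ip_lin (ipC be ga) (ipC be om) => k1 k2 k3 k4 k5 k6.
have : n.+1%:R * (ip be v - ip al v) <= 0 by rewrite pmulr_rle0.
lra.
Qed.

Lemma cluster_in_range p : cluster (P \o x @ \oo) p -> P p = p.
Proof.
move=> cl; apply/eqP; rewrite eq_sym -subr_eq0 -normr_eq0.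
apply: contraT => pP; have e0 : 0 < `|p - P p| by rewrite lt_def pP normr_ge0.
have [||n _] := cluster_often (Q := fun=> True) (B := [set q | `|p - q| < `|p - P p|]) cl.
- exact: filterE.
- by apply/nbhs_ballP; exists `|p - P p| => // t; rewrite -ball_normE.
move=> /=; rewrite ltNge.
have -> : p - P p = (p - P (x n)) - P (p - P (x n)).
  by rewrite oprojB// oprojK// opprB addrA subrK.
by rewrite oproj_compl_le.
Qed.

(** Along the cluster point, y n = P x n - v + D n comes close to p - v, while
    [value_bound] keeps f (y n) below the value at t - v up to a vanishing error. *)
Lemma cluster_minimal p t : cluster (P \o x @ \oo) p -> P t = t ->
  (f (p - v)%R <= f (t - v)%R)%E.
Proof.
move=> cl Pt; have [fN _] := pf; rewrite leNgt; apply/negP => lt_f.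
have ft : edom f (t - v) by apply: lt_le_trans lt_f (leey _).
have [a ca af] : exists2 a, fine (f (t - v)) < a & (a%:E < f (p - v)%R)%E.
  move: lt_f (fN (p - v)); rewrite (edom_fin_num fN ft) /=.
  case: (f (p - v)) => [r||]// rlt _; last by exists (fine (f (t - v)) + 1); rewrite ?ltrDl ?ltry.
  by have [] := midf_lt rlt => h1 h2; exists ((fine (f (t - v)) + r) / 2).
have [V /nbhs_ballP[e /= e0 eV] Va] := lf af.
pose B := `|t - z| + M + (M + `|s|).
have M0 : 0 <= M by exact: normr_ge0.
have B0 : 0 <= B by rewrite /B !addr_ge0.
pose d := Num.min (e / 2) ((a - fine (f (t - v))) / (B + 1)).
have d0 : 0 < d.
  by rewrite lt_min !divr_gt0//= ?subr_gt0// ltr_wpDl.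
have [|n Dn] := cluster_often (B := [set q | `|p - q| < e / 2]) cl (increments_vanish d0).
  by apply/nbhs_ballP; exists (e / 2); [exact: divr_gt0|move=> q; rewrite -ball_normE].
move=> /= pn; have yV : V (y n).
  apply: eV; rewrite -ball_normE /=.
  have -> : p - v - y n = (p - P (x n)) - D n.
    by apply: ip_ext => h; rewrite DE !ip_lin; ring.
  apply: le_lt_trans (ler_normB _ _) _; rewrite (splitr e) ltrD//.
  by apply: lt_le_trans Dn _; rewrite ge_min lexx.
have := Va _ yV; rewrite (edom_fin_num fN (subdifferential_edom pf (ys n))) lte_fin.
apply/negP; rewrite -leNgt; apply: le_trans (value_bound n Pt ft) _; rewrite -/B.
have : `|D n| <= (a - fine (f (t - v))) / (B + 1).
  by apply: ltW; apply: lt_le_trans Dn _; rewrite ge_min lexx orbT.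
rewrite ler_pdivlMr ?ltr_wpDl//; have := normr_ge0 (D n); nra.
Qed.

(** The values at p - v and z - v agree and p - z is orthogonal to s, so the affine
    minorants with slope s that touch f at these two points coincide. *)
Lemma cluster_solution p : cluster (P \o x @ \oo) p -> is_solution p.
Proof.
move=> cl; have Pp := cluster_in_range cl; split => //.
have [fN _] := pf; have fz := subdifferential_edom pf fs.
have pz := cluster_minimal cl Pz.
have fp : edom f (p - v) by apply: le_lt_trans pz fz.
apply: subdifferentialP => // t ft.
apply: le_trans (subdifferential_fine pf fs ft).
have := oproj_orth HP Pp Ps; have := oproj_orth HP Pz Ps.
move: pz; rewrite (edom_fin_num fN fz) (edom_fin_num fN fp) lee_fin.
rewrite !ip_lin; lra.
Qed.

(** The difference of the squared distances of w n to q - s and p - s is an affine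
    function of P x n alone, and it converges; its value at every cluster point is
    therefore the same, and the values at p and q differ by 2 |p - q| ^ 2. *)
Lemma cluster_unique p q :
  cluster (P \o x @ \oo) p -> cluster (P \o x @ \oo) q -> p = q.
Proof.
move=> clp clq.
have sp := cluster_solution clp; have sq := cluster_solution clq.
pose C := `|q - s| ^+ 2 - `|p - s| ^+ 2.
pose h (t : E) := 2 * ip t (p - q) + C.
have AE n : A q n - A p n = h (P (x n)).
  have Ppq : P (p - q) = p - q by rewrite oprojB// sp.1 sq.1.
  rewrite /h -Pw oproj_adj// Ppq /A /C -!ip_normE.
  move: (w n) => a; rewrite !ip_lin.
  by rewrite (ipC p a) (ipC q a) (ipC s a) (ipC s p) (ipC s q); ring.
have /cvg_ex[lp Alp] := fejer_dist_cvg sp; have /cvg_ex[lq Alq] := fejer_dist_cvg sq.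
have hl : (fun n => h (P (x n))) @ \oo --> lq - lp.
  by rewrite -(funext AE); exact: cvgB.
have hcluster t : cluster (P \o x @ \oo) t -> h t = lq - lp.
  move=> clt; apply/eqP; rewrite -subr_eq0 -normr_eq0; apply: contraT => ne.
  set e := `|h t - (lq - lp)| in ne; have e0 : 0 < e by rewrite lt_def ne normr_ge0.
  have c0 : 0 < 4 * (`|p - q| + 1) by rewrite mulr_gt0// ltr_wpDl.
  have hn : \forall n \near \oo, `|lq - lp - h (P (x n))| < e / 2.
    by move/cvgrPdist_lt : hl; apply; exact: divr_gt0.
  have [|n Qn Bn] := cluster_often
      (B := [set r | `|t - r| < e / (4 * (`|p - q| + 1))]) clt hn.
    apply/nbhs_ballP; exists (e / (4 * (`|p - q| + 1))); first exact: divr_gt0.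
    by move=> r; rewrite -ball_normE.
  rewrite /= ltr_pdivlMr// in Bn.
  have : e <= `|h t - h (P (x n))| + `|lq - lp - h (P (x n))|.
    rewrite /e -(subrKA (h (P (x n)))) distrC (distrC (lq - lp)).
    by rewrite distrC; exact: ler_normD.
  have : `|h t - h (P (x n))| <= 2 * (`|t - P (x n)| * `|p - q|).
    have -> : h t - h (P (x n)) = 2 * ip (t - P (x n)) (p - q).
      by rewrite /h ipBl; ring.
    by rewrite normrM ger0_norm// ler_pM2l// ler_norm_ip.
  have := normr_ge0 (t - P (x n)); have := normr_ge0 (p - q).
  move: Bn Qn; nra.
have : h p = h q by rewrite !hcluster.
move=> hpq; apply/subr0_eq/ip_eq0; move: hpq; rewrite /h ipBl; lra.
Qed.

(** A bounded sequence in finite dimension with a single cluster point converges. *)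
Lemma douglas_rachford_shadow_cvg : exists p, [/\ P p = p,
  forall t, P t = t -> (f (p - v)%R <= f (t - v)%R)%E & P \o x @ \oo --> p].
Proof.
have M0 : 0 <= M by exact: normr_ge0.
have bnd n : `|P (x n) - z| <= M by rewrite -Pw shadow_bounded.
have [|p [_ clp]] := @closed_ball_compact R E z M (P \o x @ \oo) _.
  by exists 0 => // n _ /=; exact: bnd.
exists p; split => [|t|]; [exact: cluster_in_range|exact: cluster_minimal|].
apply: (compact_cluster_set1 (V := [set t | `|t - p| <= M + `|z - p| + 1])).
- exact: norm_hausdorff.
- exact: closed_ball_compact.
- apply/nbhs_ballP; exists 1; first exact: ltr01.
  move=> t; rewrite -ball_normE /= distrC => /ltW.
  by move/le_trans; apply; rewrite lerDr addr_ge0.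
- exists 0 => // n _ /=; rewrite -(subrKA z).
  apply: le_trans (ler_normD _ _) _; rewrite -addrA lerD//.
  by rewrite lerDl.
- by apply/seteqP; split => [q clq|_ ->//]; exact: cluster_unique.
Qed.

End douglas_rachford_convergence.

(** * The product space and its diagonal *)

Section product_space.
Context (R : realType) (m : nat) (X : euclideanType R).
Hypothesis m0 : (0 < m)%N.
Implicit Types (x y s u : hsum m X).

Let mR : m%:R != 0 :> R. Proof. by rewrite pnatr_eq0 -lt0n. Qed.

Lemma hsumP x y : (forall i, x i = y i) -> x = y.
Proof. by move=> xy; apply/ffunP => i; exact: xy. Qed.

Lemma hsumD x y i : hsum_fun (x + y) i = x i + y i.
Proof. by rewrite /hsum_fun ffunE. Qed.

Lemma hsumZ (a : R) x i : hsum_fun (a *: x) i = a *: x i.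
Proof. by rewrite /hsum_fun ffunE. Qed.

Lemma hsumN x i : hsum_fun (- x) i = - x i.
Proof. by rewrite -scaleN1r hsumZ scaleN1r. Qed.

Lemma hsumB x y i : hsum_fun (x - y) i = x i - y i.
Proof. by rewrite hsumD hsumN. Qed.

Lemma hsum_ipE x y : ip x y = \sum_(i < m) ip (x i) (y i).
Proof. by []. Qed.

Lemma hsum_norm_le x i : `|x i| <= `|x|.
Proof.
rewrite -(ler_pXn2r (n := 2))// ?nnegrE// -!ip_normE hsum_ipE (bigD1 i)//=.
by rewrite lerDl sumr_ge0// => j _; exact: ip_ge0.
Qed.

Definition constant_tuple (t : X) : hsum m X := [ffun=> t].

Lemma constant_tupleE t i : constant_tuple t i = t.
Proof. by rewrite /hsum_fun ffunE. Qed.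

Definition average x : X := m%:R^-1 *: \sum_(i < m) x i.

Lemma average_constant t : average (constant_tuple t) = t.
Proof.
rewrite /average (eq_bigr (fun=> t)); last by move=> i _; rewrite constant_tupleE.
by rewrite sumr_const card_ord -[t *+ m]scaler_nat scalerA mulVf// scale1r.
Qed.

Definition proj_diag x : hsum m X := constant_tuple (average x).

Lemma proj_diagE x i : proj_diag x i = average x.
Proof. exact: constant_tupleE. Qed.

Lemma proj_diag_constant t : proj_diag (constant_tuple t) = constant_tuple t.
Proof. by rewrite /proj_diag average_constant. Qed.

Lemma proj_diag_oproj : orthogonal_projection proj_diag.
Proof.
split=> [a x y|x|x y].
- apply: hsumP => i; rewrite hsumD hsumZ !proj_diagE /average scalerA mulrC.
  rewrite -scalerA -scalerDr; congr (_ *: _); rewrite scaler_sumr -big_split.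
  by apply: eq_bigr => j _; rewrite hsumD hsumZ.
- exact: proj_diag_constant.
- have ip_sum (t : X) (u : hsum m X) : \sum_(i < m) ip t (u i) = ip t (\sum_(i < m) u i).
    by elim/big_rec2: _ => [|i a b _ ->]; rewrite ?ip0r ?ipDr.
  rewrite !hsum_ipE.
  under eq_bigr do rewrite proj_diagE.
  under [RHS]eq_bigr do rewrite proj_diagE ipC.
  by rewrite !ip_sum /average !ipZl ipC.
Qed.

Lemma hsum_diagE x : hsum_diag x <-> proj_diag x = x.
Proof.
split=> [[t xt]|<-]; last by exists (average x) => i; rewrite proj_diagE.
have -> : x = constant_tuple t by apply: hsumP => i; rewrite constant_tupleE.
exact: proj_diag_constant.
Qed.

Lemma orthogonal_compl_diag u : orthogonal_compl hsum_diag u -> proj_diag u = 0.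
Proof.
move=> hu; apply: ip_eq0; rewrite (oproj_adj proj_diag_oproj).
rewrite (oprojK proj_diag_oproj) ipC; apply/hu/hsum_diagE.
exact: oprojK proj_diag_oproj u.
Qed.

(** Pythagoras shows that the average is the unique nearest point of the diagonal. *)
Lemma projector_diag x : projector hsum_diag x = proj_diag x.
Proof.
have HP := proj_diag_oproj.
have pyth c : hsum_diag c ->
    `|x - c| ^+ 2 = `|proj_diag x - c| ^+ 2 + `|x - proj_diag x| ^+ 2.
  move=> /hsum_diagE Pc; rewrite (oproj_pythagoras HP) (oprojB HP) Pc.
  by rewrite opprB addrA subrK.
have Dx : hsum_diag (proj_diag x) by apply/hsum_diagE; exact: oprojK.
apply: xget_unique => [|p [Dp pmin]].
  split=> // c Dc; rewrite -(ler_pXn2r (n := 2))// ?nnegrE// (pyth c)//.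
  by rewrite lerDr sqr_ge0.
have := pmin _ Dx; rewrite -(ler_pXn2r (n := 2))// ?nnegrE// (pyth p)//.
rewrite gerDr -ip_normE => h; apply/esym/subr0_eq/ip_eq0/le_anti.
by rewrite h ip_ge0.
Qed.

Variable g : 'I_m -> X -> \bar R.
Hypothesis cg : forall i, econvex (g i).
Hypothesis lg : forall i, lower_semicontinuous (g i).
Hypothesis pg : forall i, eproper (g i).

Let gN i t : g i t != -oo%E. Proof. by have [] := pg i. Qed.

Lemma separable_sumN x : separable_sum g x != -oo%E.
Proof.
rewrite /separable_sum; elim/big_ind: _ => // a b a0 b0.
by rewrite adde_eq_ninfty negb_or a0.
Qed.

Lemma edom_separable_sum x : (forall i, edom (g i) (x i)) ->
  separable_sum g x = (\sum_(i < m) fine (g i (x i)))%:E.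
Proof.
move=> gx; rewrite -sumEFin; apply: eq_bigr => i _.
exact: edom_fin_num.
Qed.

Lemma separable_sum_econvex : econvex (separable_sum g).
Proof.
move=> x y t t01; have /andP[t0 t1] := t01.
have fsum (r : R) (z : hsum m X) :
    (r%:E * separable_sum g z = \sum_(i < m) r%:E * g i (z i))%E.
  suff [] : (separable_sum g z != -oo)%E /\
      (r%:E * separable_sum g z = \sum_(i < m) r%:E * g i (z i))%E by [].
  rewrite /separable_sum; elim/big_rec2: _ => [|i a b _ [bN <-]].
    by rewrite mule0.
  split; first by rewrite adde_eq_ninfty negb_or gN.
  by rewrite muleDr// ltninfty_adde_def// inE ltNye ?gN.
rewrite !fsum /separable_sum -big_split /=; apply: lee_sum => i _.
rewrite hsumD !hsumZ; exact: cg.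
Qed.

Lemma separable_sum_lsc : lower_semicontinuous (separable_sum g).
Proof.
apply: (lsc_sum (f := fun i (x : hsum m X) => g i (x i))) => // i.
apply: (lsc_comp (h := fun x : hsum m X => x i)) => // x.
apply/(@cvgrPdist_lt _ _ _ (nbhs x)) => e e0.
have : \forall t \near x, `|x - t| < e.
  by apply/nbhs_ballP; exists e => // t; rewrite -ball_normE.
by apply: filterS => t; apply: le_lt_trans; rewrite -hsumB hsum_norm_le.
Qed.

Lemma separable_sum_eproper : eproper (separable_sum g).
Proof.
split; first exact: separable_sumN.
have /choice[a ga] i := (pg i).2.
exists ([ffun i => a i] : hsum m X).
rewrite /edom /= edom_separable_sum ?ltry// => i.
by rewrite /hsum_fun ffunE.
Qed.

Lemma subdifferential_separable_sum x s :
  (forall i, subdifferential (g i) (x i) (s i)) ->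
  subdifferential (separable_sum g) x s.
Proof.
move=> gs y; rewrite hsum_ipE -sumEFin /separable_sum -big_split /=.
apply: lee_sum => i _; rewrite hsumB; exact: gs.
Qed.

(** Fix all the other components at points of the domains. *)
Lemma separable_minorant u (K : R) i :
  (forall x, (ip x u - K)%:E <= separable_sum g x)%E ->
  exists Ki, forall t, ((ip t (u i) - Ki)%:E <= g i t)%E.
Proof.
move=> gu; have /choice[a ga] j := (pg j).2.
pose y t : hsum m X := [ffun j => if j == i then t else a j].
have yi t : y t i = t by rewrite /hsum_fun ffunE eqxx.
have yj t j : j != i -> y t j = a j by rewrite /hsum_fun ffunE => /negPf ->.
exists (K + \sum_(j < m | j != i) fine (g j (a j)) - \sum_(j < m | j != i) ip (a j) (u j)).
move=> t; case: (ltP (g i t) +oo%E) => [git|]; last first.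
  by rewrite leye_eq => /eqP ->; rewrite leey.
have := gu (y t); rewrite edom_separable_sum; last first.
  by move=> j; have [->|ji] := eqVneq j i; rewrite ?yi ?yj.
rewrite (edom_fin_num (gN i) git) !lee_fin hsum_ipE.
rewrite (bigD1 i)//= [X in _ <= X](bigD1 i)//= !yi.
under eq_bigr do rewrite yj//.
under [X in _ <= _ + X]eq_bigr do rewrite yj//.
lra.
Qed.

Lemma conjugate_minorant u : edom (fenchel_conjugate (separable_sum g)) u ->
  exists K, forall x, ((ip x u - K)%:E <= separable_sum g x)%E.
Proof.
rewrite /edom /= /fenchel_conjugate; set c := ereal_sup _ => coo.
have [gsN [a ga]] := separable_sum_eproper.
have ub x : ((ip x u)%:E - separable_sum g x <= c)%E.
  by apply: ereal_sup_ubound; exists x.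
have cN : c != -oo%E.
  apply/eqP => cE; have := ub a; rewrite cE (edom_fin_num gsN ga).
  by rewrite -EFinB leeNy_eq.
exists (fine c) => x.
have := ub x; have := gsN x; case: (separable_sum g x) => [r||]// _.
  rewrite -(@fineK _ c) ?fin_numE ?cN ?lt_eqF// -EFinB !lee_fin; lra.
by rewrite leey.
Qed.

(** The governing point is x = (P y + P s) - (y - P y) - (s - P s): its reflection
    is y + s, whose proximal point is y. *)
Lemma subdifferential_displacement y s :
  subdifferential (separable_sum g) y s ->
  [set x - dr_op g x | x in setT] (proj_diag s - (y - proj_diag y)).
Proof.
move=> sy; have HP := proj_diag_oproj.
pose x := (proj_diag y + proj_diag s) - (y - proj_diag y) - (s - proj_diag s).
have Px : proj_diag x = proj_diag y + proj_diag s.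
  by rewrite /x !(oprojB HP) (oprojD HP) !(oprojK HP) !subrr !subr0.
exists x => //; rewrite /dr_op /reflector_diag projector_diag Px.
have -> : 2 *: (proj_diag y + proj_diag s) - x = y + s.
  by apply: ip_ext => t; rewrite /x !ip_lin; ring.
rewrite prox_subdifferential//; last exact: separable_sum_eproper.
by apply: ip_ext => t; rewrite !ip_lin; ring.
Qed.

Lemma min_displacement_le x : `|min_displacement g| <= `|x - dr_op g x|.
Proof.
(* If no nearest point exists, [projector] is 0 and the bound is trivial. *)
rewrite /min_displacement /projector; case: xgetP => [p _ [_ pmin]|_].
  have /pmin : closure [set t - dr_op g t | t in setT] (x - dr_op g x).
    by apply: subset_closure; exists x.
  by rewrite !sub0r !normrN.
by rewrite normr0.
Qed.

(** The displacements built by [displacement_approx] are all at least as long as the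
    minimal one. *)
Lemma min_displacement_minimal u (K : R) y : proj_diag u = 0 ->
  (forall x, (ip x u - K)%:E <= separable_sum g x)%E ->
  edom (separable_sum g) y -> `|min_displacement g| <= `|y - proj_diag y|.
Proof.
move=> Pu gu gy; rewrite -(ler_pXn2r (n := 2))// ?nnegrE//.
apply/ler_addgt0Pr => e e0.
have [z [s [zs le_e]]] := displacement_approx proj_diag_oproj separable_sum_econvex
  separable_sum_lsc separable_sum_eproper Pu gu gy e0.
apply: le_trans le_e; rewrite ler_pXn2r ?nnegrE//.
by have [x _ <-] := subdifferential_displacement zs; exact: min_displacement_le.
Qed.

End product_space.

Theorem corollary6p7 (R : realType) (X : euclideanType R) (m : nat)
    (g : 'I_m -> X -> \bar R) (x0 : X) (x : nat -> 'I_m -> X) (xbar : nat -> X) :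
  (2 <= m)%N ->
  (forall i, econvex (g i)) ->
  (forall i, lower_semicontinuous (g i)) ->
  (forall i, eproper (g i)) ->
  [set a + b | a in orthogonal_compl (hsum_diag : set (hsum m X))
             & b in edom (fenchel_conjugate (separable_sum g))] 0 ->
  normal_solutions g !=set0 ->
  xbar 0%N = x0 ->
  (forall i, x 0%N i = x0) ->
  (forall n i, x n.+1 i = x n i - xbar n + prox (g i) (2 *: xbar n - x n i)) ->
  (forall n, xbar n.+1 = m%:R^-1 *: \sum_(i < m) x n.+1 i) ->
  exists2 xlim : X,
    argmin (fun y => \sum_(i < m) g i (y - min_displacement g i)%R)%E xlim &
    xbar @ \oo --> xlim.
Proof.
move=> m2 cg lg pg [a aD [u gu /eqP]]; rewrite addr_eq0 => /eqP au.
move=> [z [b [Dz bD] [s gs vE]]] xb0 x00 xS xbS.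
have m0 : (0 < m)%N by exact: ltnW.
have HP := proj_diag_oproj X m0; set P := @proj_diag R m X in HP.
have pG := separable_sum_eproper pg; have cG := separable_sum_econvex cg pg.
have lG := separable_sum_lsc lg pg.
have Pu : P u = 0.
  rewrite -[u]opprK -au (oprojN HP).
  by rewrite [P a](orthogonal_compl_diag m0 aD) oppr0.
have [K minorant] := conjugate_minorant pg gu.
set v := min_displacement g in gs vE *.
have vmin := min_displacement_minimal m0 cg lg pg Pu minorant.
have Pz : P z = z by exact/(hsum_diagE m0).
have zdom := subdifferential_edom pG gs.
have Pv : P v = 0 by exact: (minimal_displacement_orth HP vmin Pz zdom).
have normal t : edom (separable_sum g) t -> ip (t - (z - v)) v <= 0.
  exact: (minimal_displacement_normal HP cG pG vmin Pz zdom).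
have Ps : P s = 0.
  have : normal_cone hsum_diag z b by [].
  rewrite normal_cone_diag => -[_ /(orthogonal_compl_diag m0) Pb].
  by have := Pv; rewrite -vE (oprojD HP) [P b]Pb add0r.
pose xx n : hsum m X := [ffun i => x n i].
pose yy n : hsum m X := [ffun i => prox (g i) (2 *: xbar n - x n i)].
have xxE n i : xx n i = x n i by rewrite /hsum_fun ffunE.
have yyE n i : yy n i = prox (g i) (2 *: xbar n - x n i) by rewrite /hsum_fun ffunE.
have Pxx n : P (xx n) = constant_tuple m (xbar n).
  case: n => [|n].
    have -> : xx 0 = constant_tuple m x0.
      by apply: hsumP => i; rewrite xxE constant_tupleE.
    by rewrite /P proj_diag_constant// xb0.
  rewrite /P /proj_diag /average xbS; congr (constant_tuple m (_ *: _)).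
  by apply: eq_bigr => i _; rewrite xxE.
have xxS n : xx n.+1 = xx n - P (xx n) + yy n.
  by apply: hsumP => i; rewrite hsumD hsumB Pxx constant_tupleE yyE !xxE xS.
have yys n : subdifferential (separable_sum g) (yy n) (2 *: P (xx n) - xx n - yy n).
  apply: subdifferential_separable_sum => i.
  rewrite !hsumB hsumZ Pxx constant_tupleE xxE yyE.
  have [Ki minorant_i] := separable_minorant pg i minorant.
  exact: subdifferential_prox minorant_i.
have [p [Pp pmin cvp]] := douglas_rachford_shadow_cvg HP lG pG Pv Pz Ps gs normal xxS yys.
have pE i : p i = average p by have := proj_diagE p i; rewrite [proj_diag p]Pp.
have sumE (q : hsum m X) t : (forall i, q i = t) ->
    separable_sum g (q - v)%R = (\sum_(i < m) g i (t - v i)%R)%E.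
  by move=> qt; apply: eq_bigr => i _; rewrite hsumB qt.
exists (average p).
  move=> y; rewrite /= -/v -(sumE _ _ pE) -(sumE _ _ (constant_tupleE y)).
  exact/pmin/proj_diag_constant.
apply/cvgrPdist_lt => e e0; move/cvgrPdist_lt : cvp => /(_ e e0).
apply: filterS => n; apply: le_lt_trans.
rewrite -(pE (Ordinal m0)) -{1}(constant_tupleE (xbar n) (Ordinal m0)) -Pxx -hsumB.
exact: hsum_norm_le.
Qed.
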